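(* Let $f(x),g(x)\in\mathbb{Z}[x]$ with $g(x)$ primitive and $\deg g(x)\geq 1$, and suppose that for all $k\in\mathbb{Z}$ ($g(k)\neq 0$ implies $g(k)\mid f(k)$ in $\mathbb{Z}$). Then $g(x)\mid f(x)$ in $\mathbb{Z}[x]$.
   Context: A polynomial in $\mathbb{Z}[x]$ is primitive if the greatest common divisor of its coefficients is a unit (i.e. $\pm 1$). *)

(* Defs.v *)
From mathcomp Require Import all_boot all_order all_algebra.

Set Implicit Arguments.
Unset Strict Implicit.
Unset Printing Implicit Defensive.

Import GRing.Theory.
Local Open Scope ring_scope.

(* [zcontents g] is the gcd of the coefficients of [g], with the sign of the
   leading coefficient. *)
Definition primitive_zpoly (g : {poly int}) : Prop :=
  zcontents g \is a GRing.unit.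

(* Divisibility in Z[x] itself: [%|] on polynomials is pseudo-divisibility,
   which over [int] amounts to divisibility in Q[x]. *)
Definition zpoly_dvd (g f : {poly int}) : Prop :=
  exists q : {poly int}, f = g * q.

(* Main.v *)
Require Import Defs.
From mathcomp Require Import all_boot all_order all_algebra.
From mathcomp Require Import zify.

Import Order.TTheory GRing.Theory Num.Theory.
Local Open Scope ring_scope.

(** Pseudo-division gives a power c of the leading coefficient of g with
    c f = q g + r and deg r < deg g.  At every integer k with g(k) <> 0, g(k)
    divides r(k); but for large k we have |r(k)| < |g(k)|, and r(k) <> 0 unless
    r = 0.  Hence r = 0, so g divides f in Q[x], and Gauss's lemma for the
    primitive polynomial g concludes. *)

Lemma eventually_sign_lead_coef (p : {poly int}) : p != 0 ->
  exists N : nat, forall n : nat, (N <= n)%N -> 0 < lead_coef p * p.[n%:Z].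
Proof.
elim/poly_ind: p => [|p c IHp]; first by rewrite eqxx.
have [-> | p_neq0] := eqVneq p 0.
  rewrite mul0r add0r polyC_eq0 => c_neq0; exists 0%N => n _.
  by rewrite lead_coefC hornerC -expr2 exprn_even_gt0.
move=> _; have [N pN] := IHp p_neq0.
have -> : lead_coef (p * 'X + c%:P) = lead_coef p.
  rewrite lead_coefDl ?lead_coefMX // size_mulX // ltnS.
  by rewrite (leq_trans (size_polyC_leq1 c)) // size_poly_gt0.
(* Positivity over the integers gives [lead_coef p * p.[n] >= 1], so its product with [n] is at
   least [n], which exceeds [|lead_coef p * c|]. *)
exists (maxn N (`|(lead_coef p * c)%R|%N).+1) => n.
rewrite geq_max => /andP[leNn ltcn].
have := pN n leNn; rewrite hornerMXaddC mulrDr mulrA.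
move: (lead_coef p * p.[_]) (lead_coef p * c) ltcn => u v ltvn u_gt0.
nia.
Qed.

Lemma poly_eq0_of_dvdz_horner (g r : {poly int}) : (size r < size g)%N ->
  (forall k : int, g.[k] != 0 -> (g.[k] %| r.[k])%Z) -> r = 0.
Proof.
move=> ltrg dvd_gr; apply/eqP/negPn/negP => r_neq0.
(* Both [g - r] and [g + r] keep the leading coefficient of [g], so at large [n] both values have
   its sign; this forces [|r(n)| < |g(n)|]. *)
have lcB : lead_coef (g - r) = lead_coef g by rewrite lead_coefDl ?size_polyN.
have lcD : lead_coef (g + r) = lead_coef g by rewrite lead_coefDl.
have g_neq0 : lead_coef g != 0.
  by rewrite lead_coef_eq0 -size_poly_gt0 (leq_trans _ ltrg).
have [|N1 gB] := @eventually_sign_lead_coef (g - r).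
  by rewrite -lead_coef_eq0 lcB.
have [|N2 gD] := @eventually_sign_lead_coef (g + r).
  by rewrite -lead_coef_eq0 lcD.
have [N3 rN] := eventually_sign_lead_coef r r_neq0.
pose n := maxn N1 (maxn N2 N3).
have := gB n; rewrite leq_maxl lcB hornerD hornerN mulrBr => /(_ isT) Bn.
have := gD n; rewrite !leq_max leqnn orbT lcD hornerD mulrDr => /(_ isT) Dn.
have := rN n; rewrite !leq_max leqnn !orbT => /(_ isT) rn.
have rn0 : r.[n%:Z] != 0 by apply: contraTneq rn => ->; rewrite mulr0 ltxx.
have gn0 : g.[n%:Z] != 0.
  apply/eqP => gn0; move: Bn Dn; rewrite gn0 mulr0.
  by move: (lead_coef g * r.[_]) => u; lia.
have := dvd_gr n%:Z gn0; rewrite dvdzE => /dvdn_leq.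
rewrite absz_gt0 => /(_ rn0); apply/negP; rewrite -ltnNge -ltz_nat !abszE.
(* Scaling by [|lead_coef g|] turns the goal into [|v| < |u|], which follows from [u - v > 0] and
   [u + v > 0]. *)
rewrite -(@ltr_pM2l _ `|lead_coef g|) ?normr_gt0 // -!normrM.
by move: Bn Dn; move: (lead_coef g * _) (lead_coef g * _) => u v; lia.
Qed.

Theorem theorem2p6 (f g : {poly int})
    (g_prim : primitive_zpoly g)
    (deg_g : (1 <= (size g).-1)%N)
    (dvd_val : forall k : int, g.[k] != 0 -> (g.[k] %| f.[k])%Z) :
  zpoly_dvd g f.
Proof.
have g_neq0 : g != 0 by rewrite -size_poly_gt0; case: (size g) deg_g.
have divE := Pdiv.Idomain.divp_eq f g.
have r0 : f %% g = 0.
  apply: (@poly_eq0_of_dvdz_horner g); first by rewrite ltn_modp.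
  move=> k gk0; have /(congr1 (horner^~ k)) := divE.
  rewrite /= hornerZ hornerD hornerM => /(canLR (addKr _)) <-.
  by rewrite rpredD ?rpredN ?dvdz_mull ?dvd_val.
(* Gauss's lemma: divisibility over the rationals gives an integral cofactor for the primitive part
   of [g]. *)
have [q fE] : {q | f = zprimitive g * q}.
  by apply: dvdpP_int; rewrite /dvdp r0.
(* The content is 1 or -1, hence its own inverse, so it can be moved from [g] into the cofactor. *)
have cc1 : zcontents g * zcontents g = 1.
  by move: g_prim; rewrite /primitive_zpoly => /orP[] /eqP ->.
exists (zcontents g *: q).
by rewrite {1}(zpolyEprim g) -scalerAl -scalerAr scalerA cc1 scale1r.
Qed.
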